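(* Let $d,n\ge1$. Let $\widetilde{\boldsymbol\rho}_n:Y_{d,n}\to\mathbb C[u^{\pm1},v]$ be the linear form given on the basis $\{t_1^{a_1}\cdots t_n^{a_n}\tilde g_w\mid a_1,\dots,a_n\in\mathbb Z/d\mathbb Z,\ w\in\mathfrak S_n\}$ of $Y_{d,n}$ by $$\widetilde{\boldsymbol\rho}_n(t_1^{a_1}\cdots t_n^{a_n}\tilde g_w)=\begin{cases}d^n&\text{if }a_1=\dots=a_n=0\text{ and }w=1,\\0&\text{otherwise.}\end{cases}$$ Then $\widetilde{\boldsymbol\rho}_n$ coincides with the symmetrizing form $$\boldsymbol\rho_n:=\bigoplus_{\mu\in\operatorname{Comp}_d(n)}\boldsymbol\tau^\mu\circ\operatorname{Tr}_{\operatorname{Mat}_{m_\mu}}\circ\Psi_\mu$$ on $Y_{d,n}$.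
   Context: Let $u,v$ be indeterminates, $A=\mathbb C[u^{\pm1},v]$, and let $\xi_1,\dots,\xi_d$ be the $d$-th roots of unity in $\mathbb C$. $\mathcal H_n$ is the unital $A$-algebra with generators $T_1,\dots,T_{n-1}$ and relations $T_iT_j=T_jT_i$ ($|i-j|>1$), $T_iT_{i+1}T_i=T_{i+1}T_iT_{i+1}$, $T_i^2=u^2+vT_i$. Permutations are multiplied as functions, $s_i=(i,i+1)$; for $w=s_{i_1}\cdots s_{i_r}$ reduced, $\tilde T_w=u^{-r}T_{i_1}\cdots T_{i_r}$. $\operatorname{Comp}_d(n)$ is the set of $d$-tuples of non-negative integers with sum $n$. For $\mu\in\operatorname{Comp}_d(n)$, $\mathfrak S^\mu\subset\mathfrak S_n$ is the Young subgroup acting on consecutive blocks of letters of sizes $\mu_1,\dots,\mu_d$; $\mathcal H^\mu\subset\mathcal H_n$ is the subalgebra generated by the $T_i$ with $s_i\in\mathfrak S^\mu$, with basis $\{\tilde T_w\mid w\in\mathfrak S^\mu\}$; $m_\mu=n!/(\mu_1!\cdots\mu_d!)$. $\boldsymbol\tau^\mu:\mathcal H^\mu\to A$ is the symmetrizing linear form with $\boldsymbol\tau^\mu(\tilde T_1)=1$ and $\boldsymbol\tau^\mu(\tilde T_w)=0$ for $1\neq w\in\mathfrak S^\mu$. $Y_{d,n}$ is the unital $A$-algebra with generators $g_1,\dots,g_{n-1},t_1,\dots,t_n$ and relations $g_ig_j=g_jg_i$ ($|i-j|>1$), $g_ig_{i+1}g_i=g_{i+1}g_ig_{i+1}$, $t_it_j=t_jt_i$,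 $g_it_j=t_{s_i(j)}g_i$, $t_j^d=1$, $g_i^2=u^2+v\,e_ig_i$, with $e_i=\frac1d\sum_{s=0}^{d-1}t_i^st_{i+1}^{-s}$. For $w=s_{i_1}\cdots s_{i_r}$ reduced, $\tilde g_w=u^{-r}g_{i_1}\cdots g_{i_r}$. For a character $\chi$ of $(\mathbb Z/d\mathbb Z)^n=\langle t_1,\dots,t_n\rangle$, $E_\chi=\prod_{i=1}^n\bigl(\frac1d\sum_{s=0}^{d-1}\chi(t_i)^st_i^{-s}\bigr)$; $w(\chi)(t_i)=\chi(t_{w^{-1}(i)})$ for $w\in\mathfrak S_n$; $\operatorname{Comp}(\chi)=\mu$ with $\mu_a=\#\{j:\chi(t_j)=\xi_a\}$; $E_\mu=\sum_{\operatorname{Comp}(\chi)=\mu}E_\chi$. The $E_\mu$ are central orthogonal idempotents with sum $1$, so $Y_{d,n}=\bigoplus_\mu E_\mu Y_{d,n}$. $\chi_1^\mu$ takes value $\xi_1$ on the first $\mu_1$ of the $t_j$'s, $\xi_2$ on the next $\mu_2$, etc.; $\pi_{1,\mu}=1,\dots,\pi_{m_\mu,\mu}$ are the minimal length representatives of the left cosets $\mathfrak S_n/\mathfrak S^\mu$; $\chi_k^\mu=\pi_{k,\mu}(\chi_1^\mu)$. $\Psi_\mu:E_\mu Y_{d,n}\to\operatorname{Mat}_{m_\mu}(\mathcal H^\mu)$ is the algebra isomorphism given on the basis $\{E_{\chi_k^\mu}\tilde g_w\}$ by $\Psi_\mu(E_{\chi_k^\mu}\tilde g_w)=\tilde T_{\pi_{k,\mu}^{-1}w\pi_{j,\mu}}\mathrm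 M_{k,j}$, where $w(\chi_j^\mu)=\chi_k^\mu$ and $\mathrm M_{k,j}$ is the elementary matrix. $\operatorname{Tr}_{\operatorname{Mat}_{m_\mu}}:\operatorname{Mat}_{m_\mu}(\mathcal H^\mu)\to\mathcal H^\mu$ is the sum of diagonal entries. Thus $\boldsymbol\rho_n(x)=\sum_\mu\boldsymbol\tau^\mu(\operatorname{Tr}_{\operatorname{Mat}_{m_\mu}}(\Psi_\mu(E_\mu x)))$. *)

(* Defs.v *)
From HB Require Import structures.
From mathcomp Require Import all_boot all_order all_fingroup all_algebra.
From mathcomp Require Import boolp classical_sets reals complex monalg.

Set Implicit Arguments.
Unset Strict Implicit.
Unset Printing Implicit Defensive.

Import GRing.Theory.
Local Open Scope ring_scope.
Local Open Scope quotient_scope.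

(* Unital associative algebras given by generators and relations:
   {malg A[{fmonom I}]} is the free associative A-algebra on I, and the
   presented algebra is its quotient by the two-sided ideal generated by the
   differences lhs - rhs of the relations. *)

Notation freealg A I := {malg A[{fmonom I}]}.

HB.lock Definition gen {A : comNzRingType} {I : choiceType} (i : I)
  : freealg A I :=
  << fmu i >>.

Lemma malg_scalerAr (A : comNzRingType) (K : monomType) (c : A)
  (x y : {malg A[K]}) : c *: (x * y) = x * (c *: y).
Proof.
suff xc : x * c%:MP = c *: x by rewrite -(mul_malgC c y) mulrA xc scalerAl.
apply/malgP=> k; rewrite mcoeffZ [x * _]fgmulgU [in RHS](monalgE x).
rewrite !raddf_sum /= mulr_sumr; apply: eq_bigr => k' _.
by rewrite mulm1 !mcoeffU mulrC mulrnAr.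
Qed.

Section FreeEval.
Variables (A S : comNzRingType) (I : choiceType) (h : I -> S).

Definition word_eval (m : {fmonom I}) : S := \prod_(i <- (m : seq I)) h i.

Lemma word_eval_mmorph : mmorphism word_eval.
Proof.
split=> [x y|]; rewrite /word_eval; last by rewrite fm1 big_nil.
by rewrite -big_cat /=; congr bigop; rewrite /mmul /= fmmulE.
Qed.
HB.instance Definition _ := monalg.isMultiplicative.Build _ _ word_eval
  word_eval_mmorph.

Lemma freealg_eval (f0 : {rmorphism A -> S}) :
  exists2 f : {rmorphism freealg A I -> S},
    forall i, f (gen i) = h i & forall a x, f (a *: x) = f0 a * f x.
Proof.
exists (mmap f0 word_eval : {rmorphism _ -> _}) => [i|a x]; last exact: mmapZ.
rewrite gen.unlock [LHS]/= mmapU /= rmorph1 mul1r /word_eval fmuE.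
exact: big_seq1.
Qed.

End FreeEval.

(* A commutative extension containing a root of x^2 = a + b x; it shows that
   the presentations below do not collapse. *)
Lemma quadratic_ext (A : comNzRingType) (a b : A) :
  exists (S : comNzRingType) (e : {rmorphism A -> S}) (x : S),
    x ^+ 2 = e a + e b * x.
Proof.
pose h : {poly A} := 'X^2 - (a%:P + b *: 'X).
have sq : (size (a%:P + b *: 'X)%R < size ('X^2 : {poly A})%R)%N.
  rewrite size_polyXn ltnS (leq_trans (size_polyD _ _)) // geq_max.
  rewrite (leq_trans (size_polyC_leq1 _)) //.
  by rewrite (leq_trans (size_scale_leq _ _)) ?size_polyX.
have hM : h \is monic by rewrite monicE lead_coefDl ?size_polyN ?lead_coefXn.
have hS : size h = 3%N by rewrite size_polyDl ?size_polyN // size_polyXn.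
pose e : {rmorphism A -> {poly %/ h}} := in_qpoly h \o polyC.
exists {poly %/ h}, e, 'qX; rewrite /e /= /qpolyX.
rewrite -rmorphXn -rmorphM -rmorphD /= mul_polyC.
apply/eqP; rewrite -subr_eq0 -rmorphB; apply/eqP/val_inj => /=.
by rewrite /mk_monic hS hM /= -/h Pdiv.RingMonic.rmodpp.
Qed.

Section PresentedAlgebra.
Variables (A : comNzRingType) (I : choiceType).
Local Notation F := (freealg A I).

Definition two_sided_ideal (J : set F) : Prop :=
  [/\ J 0,
      forall x y, J x -> J y -> J (x - y),
      forall a x, J x -> J (a * x)
    & forall a x, J x -> J (x * a)].

Definition gen_ideal (rel : F -> F -> Prop) (x : F) : Prop :=
  forall J : set F, two_sided_ideal J ->
    (forall a b, rel a b -> J (a - b)) -> J x.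

(* Algebras in the library are nontrivial rings, so a presentation carries a
   proof that its quotient is not the zero ring. *)
Record presentation := Presentation {
  prel : F -> F -> Prop;
  pres_proper : ~ gen_ideal prel 1 }.

Lemma gen_ideal_two_sided rel : two_sided_ideal (gen_ideal rel).
Proof.
split=> [J [] //|x y Jx Jy J tJ rJ|a x Jx J tJ rJ|a x Jx J tJ rJ];
  have [J0 JB Jl Jr] := tJ.
- by apply: JB; [apply: Jx|apply: Jy].
- by apply: Jl; apply: Jx.
- by apply: Jr; apply: Jx.
Qed.

Lemma gen_ideal_proper (S : nzRingType) (f : {rmorphism F -> S})
    (rel : F -> F -> Prop) :
  (forall a b, rel a b -> f a = f b) -> ~ gen_ideal rel 1.
Proof.
move=> frel /(_ [set x | f x = 0]%classic) /= H.
have /H: two_sided_ideal [set x | f x = 0]%classic.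
  split=> [|x y fx fy|a x fx|a x fx] /=.
  - exact: rmorph0.
  - by rewrite rmorphB fx fy subrr.
  - by rewrite rmorphM fx mulr0.
  - by rewrite rmorphM fx mul0r.
have frel0 a b : rel a b -> f (a - b) = 0.
  by move=> /frel fab; rewrite rmorphB fab subrr.
by move=> /(_ frel0) /eqP; rewrite rmorph1 oner_eq0.
Qed.

Variable P : presentation.

Definition pideal : {pred F} := fun x => `[< gen_ideal (prel P) x >].

Lemma pidealP x : reflect (gen_ideal (prel P) x) (x \in pideal).
Proof. exact: asboolP. Qed.

Lemma pideal_zmod_closed : zmod_closed pideal.
Proof.
have [J0 JB _ _] := gen_ideal_two_sided (prel P).
split=> [|x y /pidealP Jx /pidealP Jy]; apply/pidealP => //.
exact: JB.
Qed.
HB.instance Definition _ := GRing.isZmodClosed.Build F pideal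
  pideal_zmod_closed.

Lemma pidealMl a x : x \in pideal -> a * x \in pideal.
Proof.
have [_ _ Jl _] := gen_ideal_two_sided (prel P).
by move=> /pidealP Jx; apply/pidealP; exact: Jl.
Qed.

Lemma pidealMr a x : x \in pideal -> x * a \in pideal.
Proof.
have [_ _ _ Jr] := gen_ideal_two_sided (prel P).
by move=> /pidealP Jx; apply/pidealP; exact: Jr.
Qed.

Lemma pidealZ a x : x \in pideal -> a *: x \in pideal.
Proof. by move=> Jx; rewrite -[x]mul1r scalerAl; apply: pidealMl. Qed.

Definition presalg : Type := Quotient.quot pideal.
HB.instance Definition _ := GRing.Zmodule.on presalg.

(* The operations are locked so that unification does not unfold them. *)
Fact pres_key : unit. Proof. by []. Qed.
Definition pproj : F -> presalg :=
  locked_with pres_key (fun x => \pi_(Quotient.quot pideal) x).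
Definition plift : presalg -> F :=
  locked_with pres_key
    (fun x => generic_quotient.repr (x : Quotient.quot pideal)).

Lemma pliftK x : pproj (plift x) = x.
Proof. by rewrite /pproj /plift !locked_withE reprK. Qed.

Lemma pprojE x y : (pproj x = pproj y) <-> (x - y \in pideal).
Proof.
rewrite /pproj !locked_withE (Quotient.idealrBE pideal); split=> [e|/eqP //].
by apply/eqP.
Qed.

Lemma plift_proj x : plift (pproj x) - x \in pideal.
Proof. by apply/pprojE; rewrite pliftK. Qed.

Lemma pprojD x y : pproj (x + y) = pproj x + pproj y.
Proof. by rewrite /pproj !locked_withE Quotient.pi_add. Qed.

Definition pone : presalg := pproj 1.
Definition pmul : presalg -> presalg -> presalg :=
  locked_with pres_key (fun x y => pproj (plift x * plift y)).
Definition pscale : A -> presalg -> presalg :=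
  locked_with pres_key (fun a x => pproj (a *: plift x)).

Lemma pprojM x y : pproj (x * y) = pmul (pproj x) (pproj y).
Proof.
rewrite /pmul locked_withE; apply/pprojE; set x' := plift _; set y' := plift _.
have -> : x * y - x' * y' = x * (y - y') + (x - x') * y'.
  by rewrite mulrBr mulrBl addrA subrK.
by apply: rpredD; [apply: pidealMl|apply: pidealMr];
  rewrite -opprB rpredN plift_proj.
Qed.

Lemma pprojZ a x : pproj (a *: x) = pscale a (pproj x).
Proof.
rewrite /pscale locked_withE; apply/pprojE; rewrite -scalerBr pidealZ //.
by rewrite -opprB rpredN plift_proj.
Qed.

Lemma pmulA : associative pmul.
Proof.
by move=> x y z; rewrite -[x]pliftK -[y]pliftK -[z]pliftK -!pprojM mulrA.
Qed.
Lemma pmul1 : left_id pone pmul.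
Proof. by move=> x; rewrite -[x]pliftK -pprojM mul1r. Qed.
Lemma pmulr1 : right_id pone pmul.
Proof. by move=> x; rewrite -[x]pliftK -pprojM mulr1. Qed.
Lemma pmulDl : left_distributive pmul +%R.
Proof.
move=> x y z; rewrite -[x]pliftK -[y]pliftK -[z]pliftK.
by rewrite -pprojD -!pprojM -pprojD mulrDl.
Qed.
Lemma pmulDr : right_distributive pmul +%R.
Proof.
move=> x y z; rewrite -[x]pliftK -[y]pliftK -[z]pliftK.
by rewrite -pprojD -!pprojM -pprojD mulrDr.
Qed.
Lemma pone_neq0 : pone != 0.
Proof.
apply/eqP; rewrite -[0]pliftK => /pprojE; rewrite -[1 - _]opprB rpredN => h.
have h0 : plift 0 \in pideal.
  rewrite -[plift 0]subr0; apply/pprojE; rewrite pliftK.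
  by apply: (addrI (pproj 0)); rewrite -pprojD !addr0.
have : 1 \in pideal by rewrite -[1](subKr (plift 0)) rpredB.
by move=> /pidealP; apply: pres_proper.
Qed.

HB.instance Definition _ := GRing.Zmodule_isNzRing.Build presalg
  pmulA pmul1 pmulr1 pmulDl pmulDr pone_neq0.

Lemma pscaleA a b x : pscale a (pscale b x) = pscale (a * b) x.
Proof. by rewrite -[x]pliftK -!pprojZ scalerA. Qed.
Lemma pscale1 : left_id 1 pscale.
Proof. by move=> x; rewrite -[x]pliftK -!pprojZ scale1r. Qed.
Lemma pscaleDr : right_distributive pscale +%R.
Proof.
by move=> a x y; rewrite -[x]pliftK -[y]pliftK -pprojD -!pprojZ -pprojD scalerDr.
Qed.
Lemma pscaleDl x : {morph pscale^~ x : a b / a + b}.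
Proof. by move=> a b; rewrite -[x]pliftK -!pprojZ -pprojD scalerDl. Qed.

HB.instance Definition _ := GRing.Zmodule_isLmodule.Build A presalg
  pscaleA pscale1 pscaleDr pscaleDl.

Lemma pscaleAl (a : A) (x y : presalg) : a *: (x * y) = a *: x * y.
Proof.
rewrite -[x]pliftK -[y]pliftK.
by rewrite -[LHS]/(pscale a (pmul _ _)) -[RHS]/(pmul (pscale _ _) _)
           -!(pprojM, pprojZ) scalerAl.
Qed.

HB.instance Definition _ := GRing.Lmodule_isLalgebra.Build A presalg pscaleAl.

Lemma pscaleAr (a : A) (x y : presalg) : a *: (x * y) = x * (a *: y).
Proof.
rewrite -[x]pliftK -[y]pliftK.
by rewrite -[LHS]/(pscale a (pmul _ _)) -[RHS]/(pmul _ (pscale _ _))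
           -!(pprojM, pprojZ) malg_scalerAr.
Qed.

HB.instance Definition _ := GRing.Lalgebra_isAlgebra.Build A presalg pscaleAr.

End PresentedAlgebra.

(* A = C[u^{+-1}, v] as {poly laurent R}, where C = R[i] and laurent R is the
   ring C[u^{+-1}] realized inside the fraction field of C[u]; v is the
   polynomial variable. *)

Section LaurentPolynomials.
Variable R : realType.

Definition is_laurent : {pred {fraction {poly R[i]}}} :=
  fun x => `[< exists k (p : {poly R[i]}), x * tofrac 'X ^+ k = tofrac p >].

Lemma is_laurentP x :
  reflect (exists k (p : {poly R[i]}), x * tofrac 'X ^+ k = tofrac p)
          (x \in is_laurent).
Proof. exact: asboolP. Qed.

Lemma is_laurent_subring : subring_closed is_laurent.
Proof.
split=> [|x y|x y].
- by apply/is_laurentP; exists 0%N, 1; rewrite expr0 mulr1 rmorph1.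
- move=> /is_laurentP[k [p xp]] /is_laurentP[l [q yq]]; apply/is_laurentP.
  exists (k + l)%N, (p * 'X^l - q * 'X^k).
  rewrite rmorphB !rmorphM /= !rmorphXn /= -xp -yq exprD mulrBl !mulrA.
  by congr (_ - _); rewrite -!mulrA [X in y * X]mulrC.
- move=> /is_laurentP[k [p xp]] /is_laurentP[l [q yq]]; apply/is_laurentP.
  by exists (k + l)%N, (p * q); rewrite rmorphM /= -xp -yq exprD mulrACA.
Qed.
HB.instance Definition _ := GRing.isSubringClosed.Build _ is_laurent
  is_laurent_subring.

Record laurent := Laurent {
  laurent_val : {fraction {poly R[i]}};
  _ : laurent_val \in is_laurent }.
HB.instance Definition _ := [isSub for laurent_val].
HB.instance Definition _ := [Choice of laurent by <:].
HB.instance Definition _ := [SubChoice_isSubComNzRing of laurent by <:].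

Lemma poly_is_laurent (p : {poly R[i]}) : tofrac p \in is_laurent.
Proof. by apply/is_laurentP; exists 0%N, p; rewrite expr0 mulr1. Qed.

Lemma Xinv_is_laurent : (tofrac 'X)^-1 \in is_laurent.
Proof.
apply/is_laurentP; exists 1%N, 1; rewrite expr1 rmorph1 mulVf //.
by rewrite tofrac_eq0 polyX_eq0.
Qed.

Definition laurent_of_poly (p : {poly R[i]}) := Laurent (poly_is_laurent p).

Definition scalars : comNzRingType := {poly laurent}.

Definition uA : scalars := (laurent_of_poly 'X)%:P.
Definition uA_inv : scalars := (Laurent Xinv_is_laurent)%:P.
Definition vA : scalars := 'X.
Definition cst (c : R[i]) : scalars := (laurent_of_poly c%:P)%:P.

End LaurentPolynomials.

Arguments uA {R}.
Arguments uA_inv {R}.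
Arguments vA {R}.

Section Words.
Variable n : nat.

(* The indices 1, ..., n-1 are represented by i : 'I_n.-1 and the letters
   1, ..., n by 'I_n; the index i corresponds to the letters i and i+1. *)
Definition letter (i : 'I_n.-1) : 'I_n := widen_ord (leq_pred n) i.

Lemma next_letter_subproof (i : 'I_n.-1) : (i.+1 < n)%N.
Proof. by rewrite -ltn_predRL. Qed.
Definition next_letter (i : 'I_n.-1) : 'I_n :=
  Ordinal (next_letter_subproof i).

Definition transp (i : 'I_n.-1) : 'S_n := tperm (letter i) (next_letter i).

(* Products of permutations as functions, (w1 w2)(x) = w1 (w2 x); the
   library product (w2 * w1)%g applies its left factor first. *)
Definition pcomp (w1 w2 : 'S_n) : 'S_n := (w2 * w1)%g.

Definition word_perm (s : seq 'I_n.-1) : 'S_n :=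
  foldr (fun i w => pcomp (transp i) w) 1%g s.

Definition is_reduced (s : seq 'I_n.-1) : Prop :=
  forall s', word_perm s' = word_perm s -> (size s <= size s')%N.

(* Some reduced expression of w; the elements built from it below do not depend
   on the choice, by Matsumoto's theorem. *)
Definition reduced_word (w : 'S_n) : seq 'I_n.-1 :=
  xget [::] [set s | word_perm s = w /\ is_reduced s]%classic.

Definition len (w : 'S_n) : nat := size (reduced_word w).

Definition far (i j : 'I_n.-1) : bool := (i.+1 < j)%N || (j.+1 < i)%N.

(* d-tuples of non-negative integers with sum n; the entries are at most n. *)
Definition composition (d : nat) : Type :=
  {mu : {ffun 'I_d -> 'I_n.+1} | (\sum_a mu a == n)%N}.
HB.instance Definition _ d := Finite.on (composition d).

Section Compositions.
Variables (d : nat) (mu : composition d).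

Definition part (a : 'I_d) : nat := val mu a.

Definition psum (k : nat) : nat := (\sum_(a < d | (a < k)%N) part a)%N.

Lemma block_subproof (j : 'I_n) :
  exists a : 'I_d, (psum a <= j < psum a.+1)%N.
Proof.
have top : (j < psum d)%N.
  rewrite /psum (eq_bigl xpredT) => [|a]; last by rewrite ltn_ord.
  by rewrite (eqP (valP mu)).
case: (ex_minnP (ex_intro (fun k => (j < psum k)%N) d top)) => [[|k]] jk kmin.
  by rewrite /psum big_pred0 in jk.
have kd : (k < d)%N by apply: kmin.
exists (Ordinal kd); rewrite /= jk andbT leqNgt.
by apply/negP => /kmin; rewrite ltnn.
Qed.

(* The block of the letter j: blocks are consecutive, of sizes
   part 0, ..., part d-1. *)
Definition block (j : 'I_n) : 'I_d := xchoose (block_subproof j).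

Definition young : {set 'S_n} := [set w : 'S_n | [forall j, block (w j) == block j]].

Definition multinom : nat := (n`! %/ \prod_(a < d) (part a)`!)%N.

Definition min_coset_rep (w : 'S_n) : Prop :=
  forall y, y \in young -> (len w <= len (pcomp w y))%N.

Definition coset_rep_enum (pi : 'I_multinom -> 'S_n) : Prop :=
  [/\ injective pi,
      forall w, min_coset_rep w <-> exists k, pi k = w
    & forall k : 'I_multinom, k = 0%N :> nat -> pi k = 1%g].

(* A character chi of (Z/d)^n is given by its values on t_1, ..., t_n, and
   chi j = a stands for chi(t_j) = xi_a. *)
Definition has_comp (chi : {ffun 'I_n -> 'I_d}) : bool :=
  [forall a, #|[set j | chi j == a]| == part a].

Definition chi1 : {ffun 'I_n -> 'I_d} := [ffun j => block j].

End Compositions.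

Definition char_act d (w : 'S_n) (chi : {ffun 'I_n -> 'I_d}) :
    {ffun 'I_n -> 'I_d} :=
  [ffun j => chi ((w^-1)%g j)].

End Words.

Section Algebras.
Variables (A : comNzRingType) (u v dinv : A) (d n : nat).
Local Notation FH := (freealg A 'I_n.-1).
Local Notation FY := (freealg A ('I_n.-1 + 'I_n)%type).

Inductive hecke_rel : FH -> FH -> Prop :=
| hecke_comm i j : far i j -> hecke_rel (gen i * gen j) (gen j * gen i)
| hecke_braid (i j : 'I_n.-1) : j = i.+1 :> nat ->
    hecke_rel (gen i * gen j * gen i) (gen j * gen i * gen j)
| hecke_quad i : hecke_rel (gen i ^+ 2) ((u ^+ 2)%:A + v *: gen i).

Local Notation yg i := (gen (inl i) : FY).
Local Notation yt j := (gen (inr j) : FY).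

(* dinv stands for the scalar 1/d, and t^{-s} is written t ^+ (d - s) for
   s < d, the inverse of t ^+ s modulo t ^+ d = 1. *)
Definition ye (i : 'I_n.-1) : FY :=
  dinv *: \sum_(s < d) yt (letter i) ^+ s * yt (next_letter i) ^+ (d - s).

Inductive yokonuma_rel : FY -> FY -> Prop :=
| yok_gg i j : far i j -> yokonuma_rel (yg i * yg j) (yg j * yg i)
| yok_braid (i j : 'I_n.-1) : j = i.+1 :> nat ->
    yokonuma_rel (yg i * yg j * yg i) (yg j * yg i * yg j)
| yok_tt i j : yokonuma_rel (yt i * yt j) (yt j * yt i)
| yok_gt i j : yokonuma_rel (yg i * yt j) (yt (transp i j) * yg i)
| yok_order j : yokonuma_rel (yt j ^+ d) 1
| yok_quad i : yokonuma_rel (yg i ^+ 2) ((u ^+ 2)%:A + v *: (ye i * yg i)).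

Lemma hecke_proper : ~ gen_ideal hecke_rel 1.
Proof.
have [S [e [x xx]]] := quadratic_ext (u ^+ 2) v.
have [f fg fZ] := freealg_eval (fun _ : 'I_n.-1 => x) e.
have fM y z : f (y * z) = f y * f z by exact: rmorphM.
have fX y : f (y ^+ 2) = f y ^+ 2 by exact: rmorphXn.
have fD y z : f (y + z) = f y + f z by exact: rmorphD.
have fq a b z : f (a%:A + b *: z) = e a + e b * f z.
  have fa : f a%:A = e a by rewrite fZ (rmorph1 f) mulr1.
  by rewrite -fa -fZ; exact: fD.
refine (@gen_ideal_proper _ _ _ f hecke_rel _) => a b [i j _|i j _|i].
- by rewrite [LHS]fM [RHS]fM !fg.
- by rewrite [LHS]fM [RHS]fM [X in X * _ = _]fM [X in _ = X * _]fM !fg.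
- by rewrite fX fq fg.
Qed.

Lemma yokonuma_proper : ~ gen_ideal yokonuma_rel 1.
Proof.
have [S [e [x xx]]] := quadratic_ext (u ^+ 2) (v * (dinv * d%:R)).
pose h (k : 'I_n.-1 + 'I_n) := if k is inl _ then x else 1.
have [f fg fZ] := freealg_eval h e.
have fM y z : f (y * z) = f y * f z by exact: rmorphM.
have fX y k : f (y ^+ k) = f y ^+ k by exact: rmorphXn.
have fD y z : f (y + z) = f y + f z by exact: rmorphD.
have fq a b z : f (a%:A + b *: z) = e a + e b * f z.
  have fa : f a%:A = e a by rewrite fZ (rmorph1 f) mulr1.
  by rewrite -fa -fZ; exact: fD.
refine (@gen_ideal_proper _ _ _ f yokonuma_rel _).
move=> a b [i j _|i j _|i j|i j|j|i].
- by rewrite [LHS]fM [RHS]fM !fg.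
- by rewrite [LHS]fM [RHS]fM [X in X * _ = _]fM [X in _ = X * _]fM !fg.
- by rewrite [LHS]fM [RHS]fM !fg.
- by rewrite [LHS]fM [RHS]fM !fg mulr1 mul1r.
- by rewrite fX (rmorph1 f) fg expr1n.
- have fe : f (ye i) = e (dinv * d%:R).
    rewrite /ye fZ rmorph_sum rmorphM rmorph_nat; congr (_ * _).
    rewrite -[d in RHS]card_ord -sumr_const; apply: eq_bigr => s _.
    by rewrite fM !fX !fg !expr1n mulr1.
  rewrite fX fq fM fe !fg /= xx.
  by rewrite [e (v * _)]rmorphM mulrA.
Qed.

Definition hecke : algType A := presalg (Presentation hecke_proper).
Definition yokonuma : algType A := presalg (Presentation yokonuma_proper).

End Algebras.

Section HeckeForms.
Variables (A : comNzRingType) (u uinv v : A) (d n : nat).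
Local Notation H := (hecke u v n).

Definition hecke_T (i : 'I_n.-1) : H := pproj _ (gen i).

Definition hecke_Tw (w : 'S_n) : H :=
  uinv ^+ len w *: \prod_(i <- reduced_word w) hecke_T i.

Variable mu : composition n d.

Definition is_subalg (S : set H) : Prop :=
  [/\ S 1, forall a x y, S x -> S y -> S (a *: x + y)
    & forall x y, S x -> S y -> S (x * y)].

(* H^mu is the smallest subalgebra containing the T_i with s_i in young mu. *)
Definition in_young_hecke : {pred H} := fun x =>
  `[< forall S : set H, is_subalg S ->
      (forall i, transp i \in young mu -> S (hecke_T i)) -> S x >].

Lemma in_young_heckeP x :
  reflect (forall S : set H, is_subalg S ->
             (forall i, transp i \in young mu -> S (hecke_T i)) -> S x)
          (x \in in_young_hecke).
Proof. exact: asboolP. Qed.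

Lemma in_young_hecke_subalg : subalg_closed in_young_hecke.
Proof.
split=> [|a x y /in_young_heckeP hx /in_young_heckeP hy
         |x y /in_young_heckeP hx /in_young_heckeP hy];
  apply/in_young_heckeP => S subS genS; have [S1 SL SM] := subS.
- by [].
- by apply: SL; [apply: hx|apply: hy].
- by apply: SM; [apply: hx|apply: hy].
Qed.
HB.instance Definition _ := GRing.isSubalgClosed.Build A H in_young_hecke
  in_young_hecke_subalg.

Record young_hecke := YoungHecke {
  young_hecke_val : H;
  _ : young_hecke_val \in in_young_hecke }.
HB.instance Definition _ := [isSub for young_hecke_val].
HB.instance Definition _ := [Choice of young_hecke by <:].
HB.instance Definition _ := [SubChoice_isSubAlgebra of young_hecke by <:].

(* The equation val x = hecke_Tw w selects the element x of H^mu equal to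
   hecke_Tw w. *)
Definition is_tau (tau : {scalar young_hecke}) : Prop :=
  forall w, w \in young mu -> forall x, val x = hecke_Tw w ->
    tau x = (w == 1%g)%:R.

End HeckeForms.

Section YokonumaForms.
(* xi a stands for the image in A of the d-th root of unity xi_a. *)
Variables (A : comNzRingType) (u uinv v dinv : A) (d n : nat) (xi : 'I_d -> A).
Local Notation Y := (yokonuma u v dinv d n).

Definition yok_g (i : 'I_n.-1) : Y := pproj _ (gen (inl i)).
Definition yok_t (j : 'I_n) : Y := pproj _ (gen (inr j)).

Definition yok_gw (w : 'S_n) : Y :=
  uinv ^+ len w *: \prod_(i <- reduced_word w) yok_g i.

Definition Echi (chi : {ffun 'I_n -> 'I_d}) : Y :=
  \prod_(j < n)
    (dinv *: \sum_(s < d) xi (chi j) ^+ s *: yok_t j ^+ (d - s)).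

Definition is_rho_tilde (f : {scalar Y}) : Prop :=
  forall (a : {ffun 'I_n -> 'I_d}) (w : 'S_n),
    f ((\prod_(j < n) yok_t j ^+ a j) * yok_gw w) =
    if [forall j, a j == 0%N :> nat] && (w == 1%g) then (d ^ n)%:R else 0.

Section Component.
Variable mu : composition n d.

Definition Emu : Y := \sum_(chi | has_comp mu chi) Echi chi.

Definition in_EY : {pred Y} := fun x => `[< exists y, x = Emu * y >].

Lemma in_EYP x : reflect (exists y, x = Emu * y) (x \in in_EY).
Proof. exact: asboolP. Qed.

Lemma in_EY_submod : submod_closed in_EY.
Proof.
split=> [|a x y /in_EYP[x' ->] /in_EYP[y' ->]]; apply/in_EYP.
  by exists 0; rewrite mulr0.
by exists (a *: x' + y'); rewrite mulrDr scalerAr.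
Qed.
HB.instance Definition _ := GRing.isSubmodClosed.Build A Y in_EY in_EY_submod.

Record EY := MkEY { EY_val : Y; _ : EY_val \in in_EY }.
HB.instance Definition _ := [isSub for EY_val].
HB.instance Definition _ := [Choice of EY by <:].
HB.instance Definition _ := [SubChoice_isSubLmodule of EY by <:].

Lemma EmuM_in_EY (x : Y) : Emu * x \in in_EY.
Proof. by apply/in_EYP; exists x. Qed.

Definition EmuM (x : Y) : EY := MkEY (EmuM_in_EY x).

Variable pi : 'I_(multinom mu) -> 'S_n.

Definition chi_ (k : 'I_(multinom mu)) : {ffun 'I_n -> 'I_d} :=
  char_act (pi k) (chi1 mu).

(* The A-linear map E_mu Y -> Mat_{m_mu}(H^mu) with the prescribed values; the
   entries are compared in H through the inclusion of H^mu. *)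
Definition is_Psi (Psi : EY -> 'M[young_hecke u v mu]_(multinom mu)) : Prop :=
  (forall k j, linear (fun x => Psi x k j)) /\
  forall k j w x, char_act w (chi_ j) = chi_ k ->
    val x = Echi (chi_ k) * yok_gw w ->
    map_mx val (Psi x) =
    hecke_Tw u uinv v (pcomp (pi k)^-1%g (pcomp w (pi j))) *: delta_mx k j.

End Component.

Definition rho (tau : forall mu : composition n d, {scalar young_hecke u v mu})
    (Psi : forall mu : composition n d, EY mu -> 'M[young_hecke u v mu]_(multinom mu))
    (x : Y) : A :=
  \sum_(mu : composition n d) tau mu (\tr (Psi mu (EmuM mu x))).

End YokonumaForms.

Notation young_heckeC R mu := (young_hecke (@uA R) vA mu).
Notation yokonumaC R d n := (yokonuma (@uA R) vA (cst d%:R^-1) d n).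

(* Main.v *)
Require Import Defs.
From HB Require Import structures.
From mathcomp Require Import all_boot all_order all_fingroup all_algebra.
From mathcomp Require Import boolp classical_sets reals complex monalg.
From mathcomp Require Import zify.

Set Implicit Arguments.
Unset Strict Implicit.
Unset Printing Implicit Defensive.

Import GRing.Theory.
Local Open Scope ring_scope.

(* Both forms are linear, and the elements E_chi g_w span Y_{d,n}: the span
   contains 1 = \sum_chi E_chi, and it is stable under left multiplication by
   the generators because g_i moves past the subalgebra of the t_j and, by
   Matsumoto's theorem, g_i g_w is u g_{s_i w} up to adding v e_i g_w.  Both
   forms send E_chi g_w to 1 if w = 1 and to 0 otherwise.  For rho_tilde, only
   the term t^0 of the expansion of E_chi contributes, with coefficient d^-n.
   For rho, write chi = chi_k; the matrix Psi_mu(E_chi g_w) has a single entry,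
   which is diagonal exactly when w fixes chi, and then it is the basis element
   indexed by the conjugate pi_k^-1 w pi_k, on which tau^mu is 1 or 0. *)

(** * Reduced words and Matsumoto's theorem *)

Section Words.
Variable n : nat.
Implicit Types (i j : 'I_n.-1) (w y : 'S_n) (s t : seq 'I_n.-1).

Lemma letter_next_neq i : letter i != next_letter i.
Proof. by apply/eqP => /(congr1 val) /= /eqP; rewrite ltn_eqF. Qed.

Lemma transpK i : (transp i * transp i = 1)%g.
Proof. exact: tperm2. Qed.

Lemma transp_inj : injective (@transp n).
Proof.
move=> i j e; apply/val_inj; move: (congr1 (fun w : 'S_n => w (letter i)) e).
rewrite /= /transp tpermL.
by case: tpermP => [/(congr1 val) //|/(congr1 val) /= e1|_ _] /(congr1 val) /=;
  lia.
Qed.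

Lemma transp_far i j : far i j -> (transp i * transp j = transp j * transp i)%g.
Proof.
move=> f; apply/esym/commgP/conjg_fixP; rewrite tpermJ.
by rewrite /transp !tpermD // -val_eqE /=; move: f; rewrite /far; lia.
Qed.

(** Each side is a conjugate of one transposition by the other, and both equal the transposition of
    the outer two of the three letters. *)
Lemma transp_braid i j : j = i.+1 :> nat ->
  (transp i * transp j * transp i = transp j * transp i * transp j)%g.
Proof.
move=> ji; have ab : letter j = next_letter i by apply: val_inj.
have h k l : (transp k * transp l * transp k = transp l ^ transp k)%g.
  by rewrite conjgE tpermV mulgA.
rewrite !h !tpermJ /transp ab.
have d1 : letter i != next_letter j by rewrite -val_eqE /=; lia.
rewrite tpermR [in LHS]tpermD ?d1 //; last first.
  by rewrite -val_eqE /=; lia.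
rewrite tpermL [in RHS]tpermD //; rewrite -?val_eqE /=; try lia.
Qed.

Lemma transp_adj_noncomm i j : j = i.+1 :> nat ->
  (transp i * transp j)%g <> (transp j * transp i)%g.
Proof.
move=> ji e; have ab : letter j = next_letter i by apply: val_inj.
move: (congr1 (fun w : 'S_n => w (letter i)) e).
rewrite !permM tpermL /transp ab tpermL (@tpermD _ (next_letter i)) ?tpermL.
- by move=> /(congr1 val) /=; lia.
- by rewrite eq_sym letter_next_neq.
by rewrite -val_eqE /=; lia.
Qed.

Lemma far_cases i j : [\/ i = j, far i j, j = i.+1 :> nat | i = j.+1 :> nat].
Proof.
have [->|ij] := eqVneq i j; first by constructor 1.
have [f|nf] := boolP (far i j); first by constructor 2.
have [ji|ji] := eqVneq (j : nat) i.+1; first by constructor 3.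
by constructor 4; move: nf ij ji; rewrite /far -val_eqE /=; lia.
Qed.

Lemma word_perm_cons i s : word_perm (i :: s) = (word_perm s * transp i)%g.
Proof. by []. Qed.

Lemma word_perm_cat s t : word_perm (s ++ t) = (word_perm t * word_perm s)%g.
Proof.
elim: s => [|i s IH] /=; first by rewrite mulg1.
by rewrite /pcomp IH mulgA.
Qed.

(** * Inversions and the exchange condition *)

Lemma transp_le_lt i (p q : 'I_n) :
  (p < q)%N -> ~~ (transp i p < transp i q)%N ->
  tperm p q = transp i.
Proof.
rewrite /transp => pq; case: tpermP => [ep|ep|/eqP pl /eqP pn];
  case: tpermP => [eq|eq|/eqP ql /eqP qn]; subst => //=; move: pq;
  do ?[move: pl pn; rewrite -!val_eqE /=]; do ?[move: ql qn; rewrite -!val_eqE /=].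
all: try lia.
Qed.

(** Follow the inverted pair while peeling off the head [i]. If [transp i] keeps the order of the
    pair, the image pair is inverted by the tail; otherwise [transp i] swaps exactly this pair, and
    the head is the letter to delete. *)
Lemma strong_exchange s (p q : 'I_n) :
    (p < q)%N -> ((word_perm s)^-1%g q < (word_perm s)^-1%g p)%N ->
  exists s1 i s2, s = s1 ++ i :: s2 /\
    (word_perm s * tperm p q)%g = word_perm (s1 ++ s2).
Proof.
elim: s p q => [|i s IH] p q pq; first by rewrite invg1 !perm1; lia.
rewrite word_perm_cons invMg tpermV !permM => wpq.
have [lt|nlt] := boolP (transp i p < transp i q)%N.
  have [s1 [j [s2 [-> e]]]] := IH _ _ lt wpq.
  exists (i :: s1), j, s2; split=> //.
  rewrite !cat_cons !word_perm_cons -e -!mulgA -tpermJ conjgE /transp tpermV.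
  by rewrite -!mulgA tperm2 mulg1.
exists [::], i, s; split=> //=.
by rewrite (transp_le_lt pq nlt) -mulgA transpK mulg1.
Qed.

(** * Reduced words and length *)

Lemma is_reduced_behead i s : is_reduced (i :: s) -> is_reduced s.
Proof.
move=> red t e; rewrite -ltnS; apply: (red (i :: t)).
by rewrite !word_perm_cons e.
Qed.

Lemma is_reduced_eq s t : is_reduced s -> word_perm t = word_perm s ->
  (size t <= size s)%N -> is_reduced t.
Proof. by move=> red e le r re; apply: (leq_trans le); apply: red; rewrite re. Qed.

(** Induction on [q - p]: conjugating the transposition of [p] and [q - 1] by the simple one of
    [q - 1] and [q] gives that of [p] and [q]. *)
Lemma tperm_word (p q : 'I_n) : exists s, word_perm s = tperm p q.
Proof.
wlog pq : p q / (p <= q)%N.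
  move=> h; case: (leqP p q) => [/h //|/ltnW /h]; by rewrite tpermC.
move Ek : (q - p)%N => k; elim: k p q pq Ek => [|k IH] p q pq Ek.
  have -> : p = q by apply: val_inj => /=; lia.
  by exists [::]; rewrite tperm1.
have hi : (q.-1 < n.-1)%N by have := ltn_ord q; lia.
pose i := Ordinal hi; have nq : next_letter i = q by apply: val_inj => /=; lia.
have [|/=|s es] := IH p (letter i); [by rewrite /=; lia|lia|].
(* For neighbours the conjugation degenerates, since then [letter i] is [p] itself. *)
have [k0|k0] := eqVneq k 0%N.
  exists [:: i]; rewrite word_perm_cons mul1g /transp nq; congr tperm.
  by apply: val_inj => /=; lia.
exists (i :: s ++ [:: i]).
rewrite word_perm_cons word_perm_cat word_perm_cons mul1g es.
have -> : (transp i * tperm p (letter i) * transp i =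
    tperm p (letter i) ^ transp i)%g.
  by rewrite conjgE tpermV mulgA.
rewrite tpermJ tpermL nq tpermD // -val_eqE /=; lia.
Qed.

Lemma perm_word w : exists s, word_perm s = w.
Proof.
have [ts -> _] := prod_tpermP w; elim: ts => [|t ts [s es]].
  by exists [::]; rewrite big_nil.
have [r er] := tperm_word t.1 t.2.
by exists (s ++ r); rewrite word_perm_cat big_cons es er.
Qed.

(** Every permutation has a word, hence one of minimal size, so [xget] chooses from a nonempty set
    and never falls back on its default. *)
Lemma reduced_wordP w :
  word_perm (reduced_word w) = w /\ is_reduced (reduced_word w).
Proof.
apply: (@xgetPex _ [::] [set s | word_perm s = w /\ is_reduced s]%classic).
have [s0 e0] := perm_word w.
have ex : exists k, `[< exists2 s, word_perm s = w & size s = k >].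
  by exists (size s0); apply/asboolP; exists s0.
case: (ex_minnP ex) => k /asboolP[s es sk] kmin.
exists s; split=> // t et; rewrite sk; apply: kmin; apply/asboolP.
by exists t; rewrite ?et.
Qed.

Lemma word_perm_reduced_word w : word_perm (reduced_word w) = w.
Proof. exact: (reduced_wordP w).1. Qed.

Lemma reduced_word_reduced w : is_reduced (reduced_word w).
Proof. exact: (reduced_wordP w).2. Qed.

Lemma len_word_perm s : (len (word_perm s) <= size s)%N.
Proof. by apply: reduced_word_reduced; rewrite word_perm_reduced_word. Qed.

Lemma size_reduced s : is_reduced s -> size s = len (word_perm s).
Proof.
move=> red; apply/eqP; rewrite eqn_leq len_word_perm andbT.
by apply: red; rewrite word_perm_reduced_word.
Qed.

Lemma eq_size_reduced s t : is_reduced s -> is_reduced t ->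
  word_perm s = word_perm t -> size s = size t.
Proof. by move=> rs rt e; rewrite (size_reduced rs) e -size_reduced. Qed.

Lemma len_mulr_transp_le w i : (len (w * transp i)%g <= (len w).+1)%N.
Proof.
have := len_word_perm (i :: reduced_word w).
by rewrite word_perm_cons word_perm_reduced_word.
Qed.

Lemma odd_word_perm s : odd_perm (word_perm s) = odd (size s).
Proof.
elim: s => [|i s IH]; first by rewrite odd_perm1.
by rewrite word_perm_cons odd_permM IH odd_tperm letter_next_neq addbT.
Qed.

Lemma odd_len w : odd (len w) = odd_perm w.
Proof. by rewrite -odd_word_perm word_perm_reduced_word. Qed.

(** The length changes by at most one, and it does change because its parity is the sign of the
    permutation. *)
Lemma len_mulr_transp w i :
  len (w * transp i)%g = (len w).+1 \/ len w = (len (w * transp i)%g).+1.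
Proof.
have h1 := len_mulr_transp_le w i.
have := len_mulr_transp_le (w * transp i)%g i.
rewrite -mulgA transpK mulg1 => h2.
have := odd_len (w * transp i)%g.
rewrite odd_permM odd_tperm letter_next_neq addbT -odd_len; lia.
Qed.

(* A descent is an inversion; otherwise the exchange condition would shorten
   the product. *)
Lemma reduced_exchange s i :
    is_reduced s -> (len (word_perm s * transp i)%g < size s)%N ->
  exists s1 j s2, s = s1 ++ j :: s2 /\
    (word_perm s * transp i)%g = word_perm (s1 ++ s2).
Proof.
move=> red lt; apply: strong_exchange => //=.
case: ltngtP => // [h|/val_inj /perm_inj /eqP]; last first.
  by rewrite eq_sym (negPf (letter_next_neq i)).
pose r := reduced_word (word_perm s * transp i)%g.
have er : word_perm r = (word_perm s * transp i)%g := word_perm_reduced_word _.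
have [//||s1 [j [s2 [e1 e2]]]] := @strong_exchange r (letter i) (next_letter i).
  by rewrite er invMg tpermV !permM tpermL tpermR.
have := red (s1 ++ s2); rewrite -e2 er -mulgA transpK mulg1 => /(_ erefl).
have : (size s1 + (size s2).+1 < size s)%N.
  by move: lt; rewrite /len -/r e1 size_cat.
by rewrite size_cat; lia.
Qed.

(** Multiplying by [transp k] shortens the permutation, so it deletes a letter from [k' :: b]. That
    letter is not the head, as this would force [k = k']; putting [k] in front of what remains gives
    the word. *)
Lemma reduced_other_descent (k k' : 'I_n.-1) (a b : seq 'I_n.-1) :
    is_reduced (k :: a) -> is_reduced (k' :: b) -> k <> k' ->
    word_perm (k :: a) = word_perm (k' :: b) ->
  exists r, is_reduced (k :: k' :: r) /\
            word_perm (k :: k' :: r) = word_perm (k :: a).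
Proof.
move=> ra rb kk' eab.
have lt : (len (word_perm (k' :: b) * transp k)%g < size (k' :: b))%N.
  rewrite -eab word_perm_cons -mulgA transpK mulg1.
  rewrite (size_reduced rb) -eab -(size_reduced ra) /= ltnS.
  exact: len_word_perm.
have [[|k1 s1] [l [s2 [/= [e1 e2] E]]]] := reduced_exchange rb lt; subst.
  case: kk'; apply/transp_inj/(mulgI (word_perm s2)).
  by rewrite -[in LHS](E : _ = word_perm s2) -mulgA transpK mulg1.
exists (s1 ++ s2).
have E' : word_perm [:: k, k1 & s1 ++ s2] = word_perm (k :: a).
  by rewrite word_perm_cons -[word_perm (k1 :: _)]E -mulgA transpK mulg1.
split=> //; apply: (is_reduced_eq ra E').
move: (size_reduced rb); rewrite -eab -(size_reduced ra) /= !size_cat /=; lia.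
Qed.

(* In both cases the new word starts with the longest element of the dihedral
   group generated by s_i and s_j. *)
Lemma reduced_two_descents i j s t :
    is_reduced (i :: s) -> is_reduced (j :: t) -> i <> j ->
    word_perm (i :: s) = word_perm (j :: t) ->
  if far i j then exists r, is_reduced (i :: j :: r) /\
                    word_perm (i :: j :: r) = word_perm (i :: s)
  else exists r, is_reduced (i :: j :: i :: r) /\
                    word_perm (i :: j :: i :: r) = word_perm (i :: s).
Proof.
move=> reds redt ij e.
have [r [rr er]] := reduced_other_descent reds redt ij e.
have [fij|nfij] := boolP (far i j); first by exists r.
have [r' [rr' er']] :=
  reduced_other_descent redt rr (nesym ij) (etrans (esym e) (esym er)).
have lt : (len (word_perm (j :: i :: r') * transp i)%g < size (j :: i :: r'))%N.
  rewrite er' -e word_perm_cons -mulgA transpK mulg1.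
  rewrite (size_reduced rr') er' -e -(size_reduced reds) /= ltnS.
  exact: len_word_perm.
have adj : j = i.+1 :> nat \/ i = j.+1 :> nat.
  by case: (far_cases i j) nfij => [/ij //|->|->|->]; [|left|right].
have [s1 [l [s2 [es E]]]] := reduced_exchange rr' lt.
(* The deleted letter lies beyond the first two: deleting [j] would give equal transpositions, and
   deleting [i] would make two adjacent ones commute. *)
case: s1 es E => [|k1 [|k2 s1]] /= es E.
- case: es => e1 e2; subst; case: ij; apply/esym/transp_inj.
  apply: (mulgI (word_perm r' * transp i)%g).
  rewrite -[in RHS](E : _ = (word_perm r' * transp i)%g).
  by rewrite -[RHS]mulgA transpK mulg1.
- case: es => e1 e2 e3; subst k1 l s2.
  have {}E : (transp i * transp j = transp j * transp i)%g.
    apply: (mulgI (word_perm r')); rewrite [RHS]mulgA.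
    by rewrite -[(_ * transp j)%g in RHS]E -[RHS]mulgA transpK mulg1 !mulgA.
  by case: adj => /transp_adj_noncomm [].
case: es => e1 e2 e3; subst k1 k2; exists (s1 ++ s2).
have E' : word_perm (i :: j :: i :: s1 ++ s2) = word_perm (i :: s).
  by rewrite word_perm_cons -[word_perm (j :: _)]E -mulgA transpK mulg1 e.
split=> //; apply: (is_reduced_eq reds E').
have := size_reduced rr'; rewrite er' -e -(size_reduced reds) e3 /= !size_cat /=.
lia.
Qed.

(** Induction on the size. Words with the same head are compared through their tails. For different
    heads, two intermediate reduced words, one with each head, differ by a single commutation or
    braid move, and each is compared with the given word that shares its head. *)
Lemma matsumoto_prod (R : pzSemiRingType) (g : 'I_n.-1 -> R) :
    (forall i j, far i j -> g i * g j = g j * g i) ->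
    (forall i j, j = i.+1 :> nat -> g i * g j * g i = g j * g i * g j) ->
  forall s t, is_reduced s -> is_reduced t -> word_perm s = word_perm t ->
  \prod_(i <- s) g i = \prod_(i <- t) g i.
Proof.
move=> gC gB s t; move Ek : (size s) => k.
elim: k => [|k IH] in s t Ek *; move=> rs rt e.
  by have := eq_size_reduced rs rt e; rewrite Ek (size0nil Ek) => /esym/size0nil ->.
case: s Ek rs e => // i s [Ek] rs e.
case: t rt e => [|j t] rt e.
  by have := eq_size_reduced rs rt e.
have tl l r r' : is_reduced (l :: r) -> size r = k -> is_reduced (l :: r') ->
    word_perm (l :: r) = word_perm (l :: r') ->
    \prod_(m <- l :: r) g m = \prod_(m <- l :: r') g m.
  move=> r1 sr r2; rewrite !word_perm_cons => /mulIg er.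
  by rewrite !big_cons (IH r r') //; apply: is_reduced_behead; eassumption.
have [ij|/eqP ij] := eqVneq i j.
  by rewrite -ij in rt e *; apply: tl.
have tk : size t = k by have [] := eq_size_reduced rt rs (esym e); rewrite Ek.
suff [r [r' [ri rj ei ej eg]]] : exists r r', [/\ is_reduced (i :: r),
    is_reduced (j :: r'), word_perm (i :: r) = word_perm (i :: s),
    word_perm (j :: r') = word_perm (j :: t)
    & \prod_(m <- i :: r) g m = \prod_(m <- j :: r') g m].
  by rewrite (tl _ _ _ rs Ek ri (esym ei)) eg (tl _ _ _ rt tk rj (esym ej)).
have := reduced_two_descents rs rt ij e; case: ifPn => [fij|nfij] [r [rr er]].
  have er' : word_perm [:: j, i & r] = word_perm [:: i, j & r].
    by rewrite !word_perm_cons -!mulgA (transp_far fij).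
  exists (j :: r), (i :: r); split=> //.
  - exact: (is_reduced_eq rr er').
  - by rewrite er' er.
  - by rewrite !big_cons !mulrA gC.
have [br gb] : (transp i * transp j * transp i = transp j * transp i * transp j)%g
    /\ g i * g j * g i = g j * g i * g j.
  by case: (far_cases i j) nfij => [/ij|->|h|h] //; split;
    rewrite ?(gB _ _ h) ?(transp_braid h).
have er' : word_perm [:: j, i, j & r] = word_perm [:: i, j, i & r].
  by rewrite !word_perm_cons -!mulgA; congr mulg; rewrite !mulgA br.
exists [:: j, i & r], [:: i, j & r]; split=> //.
- exact: (is_reduced_eq rr er').
- by rewrite er' er.
- by rewrite !big_cons !mulrA gb.
Qed.

End Words.

(** * The basis E_chi g_w of the Yokonuma-Hecke algebra *)

Section Presented.
Variables (A : comNzRingType) (I : choiceType) (P : presentation A I).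

Fact pproj_is_linear : linear (pproj P).
Proof. by move=> a x y; rewrite pprojD pprojZ. Qed.
HB.instance Definition _ :=
  GRing.isLinear.Build A (freealg A I) (presalg P) *:%R (pproj P) pproj_is_linear.

Fact pproj_is_monoid_morphism : monoid_morphism (pproj P).
Proof. by split=> // x y; exact: pprojM. Qed.
HB.instance Definition _ :=
  GRing.isMonoidMorphism.Build (freealg A I) (presalg P) (pproj P)
    pproj_is_monoid_morphism.

Lemma pproj_rel a b : prel P a b -> pproj P a = pproj P b.
Proof. by move=> ab; apply/pprojE/pidealP => J _; apply. Qed.

(** Elements lift to linear combinations of monomials, and a monomial is built from 1 by left
    multiplication with generators. *)
Lemma presalg_ind (S : presalg P -> Prop) :
    (forall a x y, S x -> S y -> S (a *: x + y)) -> S 1 ->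
    (forall i x, S x -> S (pproj P (gen i) * x)) ->
  forall x, S x.
Proof.
move=> SL S1 SM x; rewrite -[x]pliftK.
have S0 : S 0 by rewrite -(addNr 1) -scaleN1r; apply: SL.
rewrite (monalgE (plift x)) linear_sum; apply: (big_ind S) => //.
  by move=> y z Sy Sz; rewrite -[y]scale1r; apply: SL.
move=> m _.
have -> : << (plift x)@_m *g m >> = (plift x)@_m *: << m >> :> freealg A I.
  apply/malgP => k; rewrite mcoeffZ !mcoeffU; by rewrite mulrnAr mulr1.
rewrite linearZ -[X in S X]addr0; apply: SL => //.
case: m => m; elim: m => [|i m IH].
  have -> : << FMonom [::] >> = 1 :> freealg A I.
    by congr << _ >>; apply/eqP; rewrite fmP fm1.
  by rewrite rmorph1.
have -> : << FMonom (i :: m) >> = gen i * << FMonom m >> :> freealg A I.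
  rewrite gen.unlock [RHS]fgmulUU mulr1; congr << _ >>; apply/eqP.
  by rewrite fmP fmM fmU.
by rewrite rmorphM; apply: SM.
Qed.

End Presented.

(** * Relations, idempotents and a spanning family of the Yokonuma-Hecke algebra *)

Section Yokonuma.
Variables (A : comNzRingType) (u uinv v dinv : A) (d n : nat) (xi : 'I_d -> A).
Implicit Types (w : 'S_n) (chi : {ffun 'I_n -> 'I_d}).
(** The scalars enter through these four identities; in [xi_orth], the orthogonality of roots of
    unity, the exponent [d - s] stands for [-s]. *)
Hypothesis uK : uinv * u = 1.
Hypothesis dK : dinv * d%:R = 1.
Hypothesis xi_d : forall a, xi a ^+ d = 1.
Hypothesis xi_orth : forall a b,
  \sum_(s < d) xi a ^+ s * xi b ^+ (d - s) = d%:R * (a == b)%:R.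
Local Notation Y := (yokonuma u v dinv d n).
Local Notation g i := (yok_g u v dinv d i : Y).
Local Notation t j := (yok_t u v dinv d j : Y).
Local Notation gw w := (yok_gw u uinv v dinv d w : Y).
Local Notation E chi := (Echi u v dinv xi chi : Y).
Local Notation char := {ffun 'I_n -> 'I_d}.

Let d_gt0 : (0 < d)%N.
Proof.
by rewrite lt0n; apply/eqP => d0; move/eqP: dK; rewrite d0 mulr0 eq_sym oner_eq0.
Qed.

Definition yok_e (i : 'I_n.-1) : Y :=
  dinv *: \sum_(s < d) t (letter i) ^+ s * t (next_letter i) ^+ (d - s).

Local Notation pr := (pproj (Presentation (@yokonuma_proper A u v dinv d n))).

Lemma yok_rel a b : yokonuma_rel u v dinv d a b -> pr a = pr b.
Proof. by move=> ab; apply: (@pproj_rel _ _ (Presentation _)). Qed.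

Lemma yok_projM x y : pr (x * y) = pr x * pr y :> Y.
Proof. exact: pprojM. Qed.

Lemma yok_projX x k : pr (x ^+ k) = pr x ^+ k :> Y.
Proof. exact: (rmorphXn pr). Qed.

Lemma yok_projZ a x : pr (a *: x) = a *: pr x :> Y.
Proof. exact: pprojZ. Qed.

Lemma yok_gC i j : far i j -> g i * g j = g j * g i.
Proof. by move=> f; rewrite /yok_g -!yok_projM; exact/yok_rel/yok_gg. Qed.

Lemma yok_gB (i j : 'I_n.-1) : j = i.+1 :> nat -> g i * g j * g i = g j * g i * g j.
Proof. by move=> f; rewrite /yok_g -!yok_projM; exact/yok_rel/yok_braid. Qed.

Lemma yok_tC (i j : 'I_n) : t i * t j = t j * t i.
Proof. by rewrite /yok_t -!yok_projM; exact/yok_rel/yok_tt. Qed.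

Lemma yok_gtE (i : 'I_n.-1) (j : 'I_n) : g i * t j = t (transp i j) * g i.
Proof. by rewrite /yok_t /yok_g -!yok_projM; exact/yok_rel/yok_gt. Qed.

Lemma yok_td j : t j ^+ d = 1.
Proof. by rewrite /yok_t -yok_projX; exact/yok_rel/yok_order. Qed.

Lemma yok_proj_e i : pr (ye dinv d i) = yok_e i.
Proof.
rewrite yok_projZ; congr (_ *: _); rewrite (linear_sum pr).
by apply: eq_bigr => s _; rewrite [LHS]yok_projM !yok_projX.
Qed.

Lemma yok_g2 i : g i ^+ 2 = (u ^+ 2)%:A + v *: (yok_e i * g i).
Proof.
rewrite -yok_proj_e /yok_g -yok_projX -yok_projM -[1](rmorph1 pr) -!yok_projZ.
by rewrite -(raddfD pr); exact/yok_rel/yok_quad.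
Qed.

(** By Matsumoto's theorem the choice made in [reduced_word] does not matter. *)
Lemma yok_gw_word s : is_reduced s ->
  gw (word_perm s) = uinv ^+ size s *: \prod_(i <- s) g i.
Proof.
move=> rs; rewrite /yok_gw -(size_reduced rs); congr (_ *: _).
apply: matsumoto_prod => //; [exact: yok_gC|exact: yok_gB|..].
- exact: reduced_word_reduced.
- exact: word_perm_reduced_word.
Qed.

Lemma yok_gw1 : gw 1%g = 1.
Proof.
have r0 : @is_reduced n [::] by move=> s.
by rewrite -[1%g]/(word_perm [::]) (yok_gw_word r0) big_nil scale1r.
Qed.

(** As functions the product is [s_i w]; prefixing [i] keeps the word reduced, and [u] compensates
    the extra [uinv] of the normalization. *)
Lemma yok_g_gw_up i w : len (w * transp i)%g = (len w).+1 ->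
  g i * gw w = u *: gw (w * transp i)%g.
Proof.
move=> up; set s := reduced_word w.
have es : word_perm (i :: s) = (w * transp i)%g.
  by rewrite word_perm_cons word_perm_reduced_word.
have rs : is_reduced (i :: s).
  move=> s' e; change ((len w).+1 <= size s')%N; rewrite -up -es -e.
  exact: len_word_perm.
rewrite -es (yok_gw_word rs) big_cons scalerA exprS mulrA (mulrC u) uK mul1r.
by rewrite -scalerAr.
Qed.

(** Going up from [w'] writes [gw w] as [uinv] times [g i * gw w'], so the quadratic relation
    applies to [g i ^+ 2]. *)
Lemma yok_g_gw_down i w : len w = (len (w * transp i)%g).+1 ->
  g i * gw w = u *: gw (w * transp i)%g + v *: (yok_e i * gw w).
Proof.
move=> down; set w' := (w * transp i)%g.
have ew : (w' * transp i)%g = w by rewrite -mulgA transpK mulg1.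
have up : g i * gw w' = u *: gw w by rewrite yok_g_gw_up ew.
have gwE : gw w = uinv *: (g i * gw w') by rewrite up scalerA uK scale1r.
have -> : g i * gw w = uinv *: (g i ^+ 2 * gw w').
  by rewrite {1}gwE -scalerAr mulrA -expr2.
move: (yok_e i) (yok_g2 i) => e ->.
rewrite mulrDl scalerDr -[_%:A * _]scalerAl mul1r scalerA expr2 mulrA uK mul1r.
congr (_ + _); rewrite -scalerAl scalerA mulrC -scalerA -mulrA.
by rewrite [uinv *: (_ * _)]scalerAr -gwE.
Qed.

(** When [x ^+ d = 1], this is the spectral projector of [x] for the eigenvalue [xi a], with
    [x ^+ (d - s)] in the role of the inverse of [x ^+ s]. *)
Definition rootproj (a : 'I_d) (x : Y) : Y :=
  dinv *: \sum_(s < d) xi a ^+ s *: x ^+ (d - s).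

Lemma EchiE chi : E chi = \prod_(j < n) rootproj (chi j) (t j).
Proof. by []. Qed.

(* The orthogonality relation of the other index, from the fact that a one-sided
   inverse of a square matrix is two-sided. *)
Lemma xi_sum (s : 'I_d) : \sum_a xi a ^+ s = d%:R * (s == 0%N :> nat)%:R.
Proof.
pose M := \matrix_(a < d, s < d) xi a ^+ s.
pose N := \matrix_(s < d, b < d) (dinv * xi b ^+ (d - s)).
have MN : M *m N = 1%:M.
  apply/matrixP => a b; rewrite !mxE.
  under eq_bigr do rewrite !mxE mulrCA.
  by rewrite -mulr_sumr xi_orth mulrA dK mul1r.
suff <- : dinv * \sum_a xi a ^+ s = (s == 0%N :> nat)%:R.
  by rewrite mulrA [_ * dinv]mulrC dK mul1r.
(* Row 0 of [N] is constant equal to [dinv], because [xi a ^+ d = 1]; entry [(0, s)] of [N *m M] is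
   therefore the wanted average. *)
have /matrixP/(_ (Ordinal d_gt0) s) := mulmx1C MN.
rewrite !mxE -val_eqE eq_sym => <-; rewrite mulr_sumr.
by apply: eq_bigr => a _; rewrite !mxE subn0 xi_d mulr1.
Qed.

Lemma sum_rootproj x : x ^+ d = 1 -> \sum_a rootproj a x = 1.
Proof.
move=> xd; rewrite /rootproj -scaler_sumr exchange_big /=.
under eq_bigr do rewrite -scaler_suml xi_sum.
rewrite (bigD1 (Ordinal d_gt0)) //= big1 => [|s s0].
  by rewrite mulr1 subn0 xd addr0 scalerA dK scale1r.
have -> : ((s : nat) == 0%N) = false by apply: negbTE.
by rewrite mulr0 scale0r.
Qed.

(** The two sides are sums of [c] over shifted ranges; the boundary terms [c 0] and [c d] agree
    since both d-th powers are 1. *)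
Lemma mul_rootproj a x : x ^+ d = 1 -> x * rootproj a x = xi a *: rootproj a x.
Proof.
move=> xd; rewrite /rootproj -scalerAr [RHS]scalerA [xi a * _]mulrC -[RHS]scalerA.
congr (_ *: _); rewrite mulr_sumr scaler_sumr.
pose c s := xi a ^+ s *: x ^+ (d.+1 - s).
transitivity (\sum_(s < d) c s).
  apply: eq_bigr => s _; rewrite -scalerAr -exprS /c subSn //.
  exact/ltnW.
transitivity (\sum_(s < d) c s.+1); last first.
  by apply: eq_bigr => s _; rewrite scalerA -exprS.
apply: (addrI (c d)); rewrite addrC -(big_ord_recr d c) big_ord_recl /=.
by congr (_ + _); rewrite /c subn0 subSnn xi_d exprS xd mulr1 expr0 expr1.
Qed.

Lemma sum_Echi : \sum_chi E chi = 1.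
Proof.
under eq_bigr do rewrite EchiE.
rewrite -(bigA_distr_bigA (fun j a => rootproj a (t j))) /=.
by rewrite big1 // => j _; rewrite sum_rootproj ?yok_td.
Qed.

Lemma comm_rootproj (x y : Y) a : GRing.comm x y -> GRing.comm x (rootproj a y).
Proof.
move=> xy; rewrite /GRing.comm -scalerAr -scalerAl mulr_sumr mulr_suml.
congr (_ *: _); apply: eq_bigr => s _; rewrite -scalerAr -scalerAl.
by congr (_ *: _); apply: commrX.
Qed.

Lemma yok_t_Echi j chi : t j * E chi = xi (chi j) *: E chi.
Proof.
(* Induction on an index list containing [j]: [t j] commutes past the other factors until it meets
   its own projector. *)
rewrite EchiE; have : j \in index_enum 'I_n by rewrite mem_index_enum.
elim: (index_enum _) => [//|k r IH]; rewrite inE big_cons =>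
  /predU1P[<-|/IH {}IH].
  by rewrite mulrA mul_rootproj ?yok_td // -scalerAl.
rewrite mulrA (comm_rootproj _ (yok_tC j k)) -mulrA IH.
by rewrite -scalerAr.
Qed.

Lemma yok_tX_Echi j k chi : t j ^+ k * E chi = xi (chi j) ^+ k *: E chi.
Proof.
elim: k => [|k IH]; first by rewrite mul1r scale1r.
by rewrite exprSr -mulrA yok_t_Echi -scalerAr IH scalerA -exprS.
Qed.

Lemma rootproj_Echi a j chi :
  rootproj a (t j) * E chi = (a == chi j)%:R *: E chi.
Proof.
rewrite -scalerAl mulr_suml.
under eq_bigr do rewrite -scalerAl yok_tX_Echi scalerA.
by rewrite -scaler_suml xi_orth scalerA mulrA dK mul1r.
Qed.

Lemma prod_eigen (J : Type) (r : seq J) (F : J -> Y) (c : J -> A) (y : Y) :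
    (forall j, F j * y = c j *: y) ->
  (\prod_(j <- r) F j) * y = (\prod_(j <- r) c j) *: y.
Proof.
move=> Fy; elim: r => [|j r IH]; first by rewrite !big_nil mul1r scale1r.
by rewrite !big_cons -mulrA IH -scalerAr Fy scalerA mulrC.
Qed.

(** Each factor of [E chi] acts on [E chi'] by 1 or 0, and by 0 wherever the characters differ. *)
Lemma Echi_mul chi chi' : E chi * E chi' = (chi == chi')%:R *: E chi'.
Proof.
rewrite {1}EchiE (prod_eigen _ (fun j => rootproj_Echi _ _ _)); congr (_ *: _).
have [->|/eqP neq] := eqVneq chi chi'.
  by rewrite big1 // => j _; rewrite eqxx.
have [j /negbTE nj] : exists j, chi j != chi' j.
  by apply/existsP; apply: contra_notT neq => /existsPn h; apply/ffunP => j;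
     apply/eqP; rewrite -[_ == _]negbK.
by rewrite (bigD1 j) //= nj mul0r.
Qed.

Lemma Emu_Echi mu chi : Emu u v dinv xi mu * E chi = (has_comp mu chi)%:R *: E chi.
Proof.
rewrite /Emu mulr_suml; under eq_bigr do rewrite Echi_mul.
have [h|h] := boolP (has_comp mu chi).
  rewrite (bigD1 chi) //= eqxx big1 ?addr0 // => c /andP[_ /negbTE ->].
  by rewrite scale0r.
rewrite scale0r big1 // => c hc.
case: eqP hc => [->|_ _]; last by rewrite scale0r.
by rewrite (negPf h).
Qed.

(* Working with this predicate, rather than with an explicit expansion along the
   E_chi, avoids reordering products when g_i moves past E_chi. *)
Definition diagonal (x : Y) : Prop := forall chi, exists c, x * E chi = c *: E chi.

Lemma diagonal_t j : diagonal (t j).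
Proof. by move=> chi; exists (xi (chi j)); exact: yok_t_Echi. Qed.

Lemma diagonal1 : diagonal 1.
Proof. by move=> chi; exists 1; rewrite mul1r scale1r. Qed.

Lemma diagonalM x y : diagonal x -> diagonal y -> diagonal (x * y).
Proof.
move=> dx dy chi; have [[c xc] [c' yc]] := (dx chi, dy chi); exists (c' * c).
by rewrite -mulrA yc -scalerAr xc scalerA.
Qed.

Lemma diagonalD x y : diagonal x -> diagonal y -> diagonal (x + y).
Proof.
move=> dx dy chi; have [[c xc] [c' yc]] := (dx chi, dy chi); exists (c + c').
by rewrite mulrDl xc yc scalerDl.
Qed.

Lemma diagonalZ a x : diagonal x -> diagonal (a *: x).
Proof.
by move=> dx chi; have [c xc] := dx chi; exists (a * c); rewrite -scalerAl xc scalerA.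
Qed.

Lemma diagonalX x k : diagonal x -> diagonal (x ^+ k).
Proof.
move=> dx; elim: k => [|k IH]; first exact: diagonal1.
by rewrite exprS; apply: diagonalM.
Qed.

Lemma diagonal_sum (J : Type) (r : seq J) (F : J -> Y) :
  (forall j, diagonal (F j)) -> diagonal (\sum_(j <- r) F j).
Proof.
move=> dF; apply: big_ind => //; last exact: diagonalD.
by move=> chi; exists 0; rewrite mul0r scale0r.
Qed.

Lemma diagonal_rootproj a x : diagonal x -> diagonal (rootproj a x).
Proof.
by move=> dx; apply/diagonalZ/diagonal_sum => s; apply/diagonalZ/diagonalX.
Qed.

Lemma diagonal_e i : diagonal (yok_e i).
Proof.
apply/diagonalZ/diagonal_sum => s.
by apply: diagonalM; apply/diagonalX/diagonal_t.
Qed.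

Lemma yok_g_Echi i chi : exists2 x, diagonal x & g i * E chi = x * g i.
Proof.
(* Moving [g i] to the right turns each [t j] into [t (transp i j)]; the factors keep their order,
   and only diagonality of the product matters. *)
exists (\prod_(j < n) rootproj (chi j) (t (transp i j))).
  apply: big_ind => [||j _]; [exact: diagonal1|exact: diagonalM|].
  exact/diagonal_rootproj/diagonal_t.
have gX j k : g i * t j ^+ k = t (transp i j) ^+ k * g i.
  elim: k => [|k IH]; first by rewrite !expr0 mulr1 mul1r.
  by rewrite exprS mulrA yok_gtE -mulrA IH mulrA -exprS.
rewrite EchiE; elim: (index_enum _) => [|j r IH].
  by rewrite !big_nil mulr1 mul1r.
rewrite !big_cons -mulrA -IH mulrA [RHS]mulrA; congr (_ * _).
rewrite -scalerAr -scalerAl mulr_sumr mulr_suml; congr (_ *: _).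
by apply: eq_bigr => s _; rewrite -scalerAr -scalerAl gX.
Qed.

Lemma yokonuma_span (S : Y -> Prop) :
    (forall a x y, S x -> S y -> S (a *: x + y)) ->
    (forall chi w, S (E chi * gw w)) ->
  forall x, S x.
Proof.
pose linear_closed (S : Y -> Prop) := forall a x y, S x -> S y -> S (a *: x + y).
(* Stability under left multiplication is provable for the span itself, but not for an arbitrary [S]
   containing it. *)
pose span x := forall S : Y -> Prop,
  linear_closed S -> (forall chi w, S (E chi * gw w)) -> S x.
move=> SL SE x; suff: span x by apply.
have spanL : linear_closed span.
  by move=> a y z sy sz S' L' E'; apply: (L'); [apply: (sy S')|apply: (sz S')].
have spanE chi w : span (E chi * gw w) by move=> S' _; apply.
have spanZ a y : span y -> span (a *: y).
  move=> sy; have -> : a *: y = (a - 1) *: y + y by rewrite scalerBl scale1r subrK.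
  exact: spanL.
have spanD y z : span y -> span z -> span (y + z).
  by rewrite -[y in y + z]scale1r; exact: spanL.
have span_ind (f : Y -> Y) : linear f -> (forall chi w, span (f (E chi * gw w))) ->
    forall y, span y -> span (f y).
  move=> lf fE y /(_ (fun y => span (f y))) /=; apply=> // a y' z sy sz.
  by rewrite lf; apply: (spanL).
have span_diag y z : diagonal y -> span z -> span (y * z).
  move=> dy; apply: (span_ind (fun z => y * z)) => [a z1 z2|chi w].
    by rewrite mulrDr -scalerAr.
  by have [c yc] := dy chi; rewrite mulrA yc -scalerAl; apply: (spanZ).
have span_gw w : span (gw w).
  have span0 : span 0.
    by rewrite -(scale0r (E [ffun=> Ordinal d_gt0] * gw 1%g)); apply: (spanZ).
  rewrite -[gw w]mul1r -sum_Echi mulr_suml.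
  by apply: (big_ind span) => // y z; apply: (spanD).
apply: presalg_ind => [||[i|j] y].
- exact: spanL.
- by have := span_gw 1%g; rewrite yok_gw1.
- apply: (span_ind (fun z => g i * z)) => [a z1 z2|chi w].
    by rewrite mulrDr -scalerAr.
  (* The diagonal factor [z] preserves the span, which leaves [g i * gw w], computed according to
     whether the length rises or falls. *)
  have [z dz gE] := yok_g_Echi i chi.
  rewrite mulrA gE -mulrA; apply: (span_diag) => //.
  have [up|down] := len_mulr_transp w i.
    by rewrite yok_g_gw_up //; apply: (spanZ).
  rewrite yok_g_gw_down //; apply: (spanL) => //; apply: (spanZ).
  apply: (span_diag) => //.
  exact: diagonal_e.
- by apply: (span_diag); exact: diagonal_t.
Qed.

Lemma rho_tilde_Echi (f : {scalar Y}) chi w :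
  is_rho_tilde uinv f -> f (E chi * gw w) = (w == 1%g)%:R.
Proof.
move=> fP.
(* Exponents are reduced modulo [d] to match the basis on which [f] is prescribed; the value [d],
   coming from [s = 0], becomes 0. *)
have ltd (s : 'I_d) : ((d - s) %% d < d)%N by rewrite ltn_mod.
pose neg (s : 'I_d) := Ordinal (ltd s).
have neg0 s : (neg s == 0%N :> nat) = (s == Ordinal d_gt0).
  rewrite -val_eqE /=; case: s => [[|s] sd] /=; first by rewrite subn0 modnn.
  by rewrite modn_small; lia.
have tneg j (s : 'I_d) : t j ^+ (d - s) = t j ^+ neg s.
  rewrite {1}(divn_eq (d - s) d) exprD mulnC exprM yok_td expr1n mul1r //.
rewrite EchiE.
have -> : \prod_(j < n) rootproj (chi j) (t j) =
    \sum_(b : char) (\prod_j (dinv * xi (chi j) ^+ b j)) *: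
      \prod_j t j ^+ [ffun j => neg (b j)] j.
  rewrite /rootproj; under eq_bigr do rewrite scaler_sumr.
  rewrite bigA_distr_bigA; apply: eq_bigr => b _; rewrite -scaler_prod.
  by apply: eq_bigr => j _; rewrite scalerA ffunE tneg.
rewrite mulr_suml linear_sum /=.
under eq_bigr do rewrite -scalerAl linearZ fP /=.
have all0 (b : char) : [forall j, [ffun j => neg (b j)] j == 0%N :> nat] =
    (b == [ffun=> Ordinal d_gt0]).
  apply/forallP/eqP => [h|-> j]; last by rewrite !ffunE neg0.
  by apply/ffunP => j; have := h j; rewrite !ffunE neg0 => /eqP.
under eq_bigr do rewrite all0.
(* Only the zero exponent function contributes; its coefficient [dinv ^+ n] cancels [d ^ n]. *)
rewrite (bigD1 [ffun=> Ordinal d_gt0]) //= [X in _ + X]big1; last first.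
  by move=> b /negbTE ->; exact: mulr0.
rewrite eqxx addr0 /=; under eq_bigr do rewrite ffunE /= expr0 mulr1.
rewrite prodr_const card_ord natrX; case: eqP => _; last exact: mulr0.
by rewrite -exprMn dK expr1n.
Qed.

End Yokonuma.

(** * The form rho *)

Section Characters.
Variables n d : nat.
Implicit Types (chi : {ffun 'I_n -> 'I_d}) (w y : 'S_n) (mu : composition n d).

Lemma char_act1 chi : char_act 1%g chi = chi.
Proof. by apply/ffunP => j; rewrite ffunE invg1 perm1. Qed.

Lemma char_actM w y chi : char_act w (char_act y chi) = char_act (y * w)%g chi.
Proof. by apply/ffunP => j; rewrite !ffunE invMg permM. Qed.

Lemma has_comp_act mu w chi : has_comp mu (char_act w chi) = has_comp mu chi.
Proof.
apply: eq_forallb => a; congr (_ == _).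
rewrite -[RHS](card_imset _ (@perm_inj _ w)); apply: eq_card => j.
rewrite inE ffunE; apply/idP/imsetP => [h|[k]].
  by exists ((w^-1)%g j); rewrite ?inE ?permKV.
by rewrite inE => h ->; rewrite permK.
Qed.

Lemma has_comp_ex chi : exists mu, has_comp mu chi.
Proof.
have lt a : (#|[set j | chi j == a]| < n.+1)%N.
  by rewrite ltnS -[X in (_ <= X)%N]card_ord; exact: max_card.
pose m := [ffun a => Ordinal (lt a)].
have sm : (\sum_a m a == n)%N.
  rewrite -[X in _ == X]card_ord -sum1_card (partition_big chi xpredT) //=.
  apply/eqP/eq_bigr => a _; rewrite ffunE /= -sum1_card.
  by apply: eq_bigl => j; rewrite inE.
exists (exist _ m sm); apply/forallP => a.
by rewrite /part /= ffunE.
Qed.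

Lemma has_comp_inj mu mu' chi : has_comp mu chi -> has_comp mu' chi -> mu = mu'.
Proof.
move=> /forallP h /forallP h'; apply/val_inj/ffunP => a; apply/val_inj.
by rewrite -[LHS](eqP (h a)) (eqP (h' a)).
Qed.

Lemma psumS mu (a : 'I_d) : psum mu a.+1 = (psum mu a + part mu a)%N.
Proof.
rewrite /psum (bigD1 a) //= addnC; congr (_ + _)%N.
by apply: eq_bigl => b; rewrite -val_eqE /= ltnS leq_eqVlt; lia.
Qed.

Lemma psum_mono mu k l : (k <= l)%N -> (psum mu k <= psum mu l)%N.
Proof.
move=> kl; rewrite /psum big_mkcond [leqRHS]big_mkcond /=.
by apply: leq_sum => a _; case: ltnP => // ak; rewrite (leq_trans ak kl).
Qed.

Lemma psum_d mu : psum mu d = n.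
Proof.
rewrite /psum (eq_bigl xpredT) => [|a]; last by rewrite ltn_ord.
exact/eqP/(valP mu).
Qed.

(** The partial sums are monotone, so the intervals are disjoint and the choice made in [block] is
    forced. *)
Lemma blockE mu (j : 'I_n) (a : 'I_d) :
  (block mu j == a) = (psum mu a <= j < psum mu a.+1)%N.
Proof.
have /andP[lo hi] := xchooseP (block_subproof mu j).
rewrite -/(block mu j) in lo hi.
apply/eqP/idP => [<-|/andP[lo' hi']]; first by rewrite lo hi.
apply: val_inj; case: (ltngtP (block mu j) a) => // h.
  by have := psum_mono mu h; lia.
by have := psum_mono mu h; lia.
Qed.

Lemma has_comp_chi1 mu : has_comp mu (chi1 mu).
Proof.
apply/forallP => a.
have le : (psum mu a.+1 <= n)%N by rewrite -[leqRHS](psum_d mu); apply: psum_mono.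
have -> : #|[set j | chi1 mu j == a]| =
    #|[set j : 'I_n | (psum mu a <= j < psum mu a.+1)%N]|.
  by apply: eq_card => j; rewrite !inE ffunE blockE.
rewrite -sum1_card.
rewrite (eq_bigl (fun j : 'I_n => (psum mu a <= j < psum mu a.+1)%N)) => [|j];
  last by rewrite inE.
rewrite -(big_mkord (fun j => psum mu a <= j < psum mu a.+1)%N (fun=> 1%N)).
apply/eqP; transitivity (\sum_(psum mu a <= j < psum mu a.+1) 1)%N.
  rewrite (big_nat_widen _ _ _ _ _ le) [RHS](big_nat_widenl _ 0) // /=.
  by apply: eq_bigl => j; rewrite andbC.
by rewrite sum_nat_const_nat muln1 psumS addKn.
Qed.

(** Equal fibre sizes make the two tuples of values permutations of each other. *)
Lemma char_transitive mu chi chi' :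
  has_comp mu chi -> has_comp mu chi' -> exists w, char_act w chi = chi'.
Proof.
move=> h h'.
have count_char c a : has_comp mu c -> count_mem a [tuple c j | j < n] = part mu a.
  move=> /forallP/(_ a)/eqP <-; rewrite count_map -sum1_count big_enum_cond /=.
  by rewrite -sum1_card; apply: eq_bigl => j; rewrite inE.
have /tuple_permP[p ep] :
    perm_eq [tuple chi' j | j < n] [tuple chi j | j < n].
  by apply/allP => a _ /=; rewrite (count_char _ _ h) (count_char _ _ h').
(* The inverse appears because [char_act] precomposes with the inverse permutation. *)
exists (p^-1)%g; apply/ffunP => j; rewrite ffunE invgK.
have := congr1 (fun t => nth (chi j) t j) ep.
rewrite -!tnth_nth.
by rewrite !tnth_mktuple.
Qed.

Lemma youngP mu w : reflect (char_act w (chi1 mu) = chi1 mu) (w \in young mu).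
Proof.
apply: (iffP idP) => [|h]; rewrite inE.
  move=> /forallP h; apply/ffunP => j; rewrite !ffunE.
  by have := h ((w^-1)%g j); rewrite permKV => /eqP.
apply/forallP => j; apply/eqP.
by move/ffunP: h => /(_ (w j)); rewrite !ffunE permK.
Qed.

(** Some [w] sends [chi1] to [chi]. A shortest element of its coset acts in the same way, since
    [young] fixes [chi1], and it is one of the [pi k]. *)
Lemma coset_rep_chi mu (pi : 'I_(multinom mu) -> 'S_n) chi :
  coset_rep_enum pi -> has_comp mu chi -> exists k, chi_ pi k = chi.
Proof.
move=> [_ pis _] hc; have [w wE] := char_transitive (has_comp_chi1 mu) hc.
have y1 : (1%g : 'S_n) \in young mu by apply/youngP; exact: char_act1.
case: (arg_minnP (fun y => len (Defs.pcomp w y)) y1) => y yY ymin.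
have /pis[k pik] : min_coset_rep mu (Defs.pcomp w y).
  move=> z zY; rewrite /Defs.pcomp mulgA; apply: (ymin (z * y)%g).
  by apply/youngP; rewrite -char_actM (youngP _ _ zY) (youngP _ _ yY).
by exists k; rewrite /chi_ pik /Defs.pcomp -char_actM (youngP _ _ yY).
Qed.

End Characters.

(** * Linearity of rho and its values on the spanning family *)

Section Rho.
Variables (A : comNzRingType) (u uinv v dinv : A) (d n : nat) (xi : 'I_d -> A).
Hypothesis uK : uinv * u = 1.
Hypothesis dK : dinv * d%:R = 1.
Hypothesis xi_d : forall a, xi a ^+ d = 1.
Hypothesis xi_orth : forall a b,
  \sum_(s < d) xi a ^+ s * xi b ^+ (d - s) = d%:R * (a == b)%:R.
Local Notation Y := (yokonuma u v dinv d n).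
Variable pi : forall mu : composition n d, 'I_(multinom mu) -> 'S_n.
Hypothesis pi_enum : forall mu, coset_rep_enum (@pi mu).
Variable tau : forall mu : composition n d, {scalar young_hecke u v mu}.
Hypothesis tauP : forall mu, is_tau uinv (tau mu).
Variable Psi : forall mu : composition n d,
  EY u v dinv xi mu -> 'M[young_hecke u v mu]_(multinom mu).
Hypothesis PsiP : forall mu, is_Psi uinv (@pi mu) (@Psi mu).

Lemma EmuM_linear mu : linear (@EmuM A u v dinv d n xi mu).
Proof.
by move=> a x y; apply: val_inj; rewrite linearP /= mulrDr -scalerAr.
Qed.

Lemma rho_linear a x y :
  rho tau (@Psi) (a *: x + y) = a * rho tau (@Psi) x + rho tau (@Psi) y.
Proof.
rewrite /rho mulr_sumr -big_split; apply: eq_bigr => mu _ /=.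
rewrite EmuM_linear /mxtrace -[a * _]/(a *: _) -linearP; congr (tau mu _).
rewrite scaler_sumr -big_split; apply: eq_bigr => k _ /=.
by have [-> _] := PsiP mu.
Qed.

Lemma rho_Echi chi w :
  rho tau (@Psi) (Echi u v dinv xi chi * yok_gw u uinv v dinv d w) =
  (w == 1%g)%:R.
Proof.
have [mu hmu] := has_comp_ex chi.
(* Only the component of [chi] survives, because the other [Emu] annihilate [E_chi]. *)
rewrite /rho (bigD1 mu) //= [X in _ + X]big1 ?addr0 => [|mu' neq]; last first.
  have -> : EmuM xi mu' (Echi u v dinv xi chi * yok_gw u uinv v dinv d w) = 0.
    apply: val_inj; rewrite /= mulrA (Emu_Echi u v dK xi_d xi_orth).
    have [h|] := boolP (has_comp mu' chi); last by rewrite scale0r mul0r.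
    by rewrite (has_comp_inj h hmu) eqxx in neq.
  rewrite -[X in \tr X]/(@Psi mu' 0).
  have -> : \tr (@Psi mu' 0) = 0.
    rewrite /mxtrace big1 // => k _.
    (* Linearity of an entry with scalar -1 and both arguments 0 makes that entry vanish at 0. *)
    have [/(_ k k (-1) 0 0)] := PsiP mu'.
    by rewrite scaler0 addr0 scaleN1r addNr.
  by rewrite linear0.
have [k ek] := coset_rep_chi (pi_enum mu) hmu.
have [PsiL PsiE] := PsiP mu.
set x := EmuM _ _ _.
have xE : val x = Echi u v dinv xi chi * yok_gw u uinv v dinv d w.
  by rewrite /= mulrA (Emu_Echi u v dK xi_d xi_orth) hmu scale1r.
have [j ej] : exists j, char_act w (chi_ (@pi mu) j) = chi.
  have := coset_rep_chi (pi_enum mu) (chi := char_act w^-1%g chi).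
  rewrite has_comp_act => /(_ hmu)[j ej]; exists j.
  by rewrite ej char_actM mulVg char_act1.
(* [PE] locates the nonzero entry at [(k, j)]; [PEk] puts it directly on the diagonal once [w] is
   known to fix [chi]. *)
have := PsiE k k w x; have := PsiE k j w x; rewrite !ek ej => /(_ erefl xE) PE PEk.
have [wk|wk] := eqVneq (char_act w chi) chi.
  have {PEk} PE := PEk wk xE.
  set y := Defs.pcomp _ _ in PE.
  (* The conjugate [y] stabilizes [chi1] because [w] stabilizes its image [chi] under [pi k]. *)
  have yY : y \in young mu.
    apply/youngP; rewrite /y /Defs.pcomp -!char_actM.
    rewrite -[char_act (@pi mu k) _]/(chi_ (@pi mu) k).
    by rewrite ek wk -ek /chi_ char_actM mulgV char_act1.
  have -> : (w == 1%g) = (y == 1%g).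
    rewrite /y /Defs.pcomp; apply/eqP/eqP => [->|h]; first by rewrite mulg1 mulgV.
    apply: (mulgI (@pi mu k)); apply: (mulIg (@pi mu k)^-1%g).
    by rewrite h mulg1 mulgV.
  apply: (tauP (mu := mu)) yY _ _.
  rewrite /mxtrace raddf_sum (bigD1 k) //= big1 ?addr0 => [|l lk].
    have /matrixP/(_ k k) := PE; rewrite !mxE => ->.
    by rewrite !eqxx mulr1.
  have /matrixP/(_ l l) := PE; rewrite !mxE => ->.
  by rewrite (negPf lk) mulr0.
have -> : (w == 1%g) = false.
  by apply/negP => /eqP w1; rewrite w1 char_act1 eqxx in wk.
(* A diagonal entry could be nonzero only if [j = k], which would make [w] fix [chi]. *)
have -> : \tr (@Psi mu x) = 0; last exact: linear0.
apply: val_inj; rewrite /mxtrace raddf_sum big1 //= => l _.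
have /matrixP/(_ l l) := PE; rewrite !mxE => ->.
case: (l =P k) => [lk|_]; last by rewrite mulr0.
case: (l =P j) => [lj|_]; last by rewrite mulr0.
by move: wk; rewrite -{1}ek -lk lj ej eqxx.
Qed.

Lemma rho_tilde_eq_rho (f : {scalar Y}) : is_rho_tilde uinv f -> f =1 rho tau (@Psi).
Proof.
move=> fP; apply: (yokonuma_span uK dK xi_d xi_orth) => [a x y fx fy|chi w].
  by rewrite linearP rho_linear fx fy.
by rewrite (rho_tilde_Echi _ dK) // rho_Echi.
Qed.

End Rho.

(** This is a geometric sum in [x / y]; multiplied by [x / y - 1] it becomes
    [(x / y) ^+ d - 1 = 0]. *)
Lemma sum_unity_roots (F : fieldType) (d : nat) (x y : F) :
    x ^+ d = 1 -> y ^+ d = 1 ->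
  \sum_(s < d) x ^+ s * y ^+ (d - s) = d%:R * (x == y)%:R.
Proof.
move=> xd yd; have [->|d_gt0] := posnP d; first by rewrite big_ord0 mul0r.
have y0 : y != 0.
  by apply: contra_eq_neq yd => ->; rewrite expr0n gtn_eqF // eq_sym oner_neq0.
transitivity (\sum_(s < d) (x / y) ^+ s).
  by apply: eq_bigr => s _; rewrite expr_div_n expfB ?yd ?mul1r.
have [->|xy] := eqVneq x y.
  under eq_bigr do rewrite divff // expr1n.
  by rewrite sumr_const card_ord mulr1.
have z1 : x / y - 1 != 0.
  by rewrite subr_eq0; apply: contra xy => /eqP e; rewrite -[x](divfK y0) e mul1r.
apply: (mulfI z1); rewrite -subrX1 expr_div_n xd yd divr1 subrr.
by rewrite !mulr0.
Qed.

Lemma rmorph_invnat (F : fieldType) (A : comNzRingType) (f : {rmorphism F -> A})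
    (d : nat) :
  d%:R != 0 :> F -> f d%:R^-1 * d%:R = 1.
Proof.
by move=> d0; rewrite -(rmorph_nat f) -rmorphM mulVf ?rmorph1.
Qed.

(** The geometric argument divides, so orthogonality is proved in the field and carried to the ring
    of scalars by the morphism. *)
Lemma rmorph_sum_unity_roots (F : fieldType) (A : comNzRingType)
    (f : {rmorphism F -> A}) (d : nat) (x y : F) :
    x ^+ d = 1 -> y ^+ d = 1 ->
  \sum_(s < d) f x ^+ s * f y ^+ (d - s) = d%:R * (x == y)%:R.
Proof.
move=> xd yd; transitivity (f (d%:R * (x == y)%:R)).
  rewrite -sum_unity_roots // rmorph_sum; apply: eq_bigr => s _.
  by rewrite rmorphM !rmorphXn.
by rewrite rmorphM !rmorph_nat.
Qed.

Section Scalars.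
Variable R : realType.

Fact laurent_of_poly_is_zmod_morphism : zmod_morphism (@laurent_of_poly R).
Proof. by move=> p q; apply: val_inj; rewrite /= rmorphB. Qed.
HB.instance Definition _ := GRing.isZmodMorphism.Build _ _ (@laurent_of_poly R)
  laurent_of_poly_is_zmod_morphism.

Fact laurent_of_poly_is_monoid_morphism : monoid_morphism (@laurent_of_poly R).
Proof.
by split=> [|p q]; apply: val_inj; rewrite /= ?rmorph1 ?rmorphM.
Qed.
HB.instance Definition _ := GRing.isMonoidMorphism.Build _ _ (@laurent_of_poly R)
  laurent_of_poly_is_monoid_morphism.

Lemma cst_rmorphism : exists f : {rmorphism R[i] -> scalars R}, f =1 @cst R.
Proof. by exists (polyC \o @laurent_of_poly R \o polyC). Qed.

Lemma uA_invK : uA_inv * uA = 1 :> scalars R.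
Proof.
rewrite -polyCM -[1]/(1%:P); congr (_%:P); apply: val_inj => /=.
by rewrite mulVf // tofrac_eq0 polyX_eq0.
Qed.

End Scalars.

Theorem proposition4p5 (R : realType) (d n : nat)
    (d_gt0 : (0 < d)%N) (n_gt0 : (0 < n)%N)
    (xi : 'I_d -> R[i]) (xi_inj : injective xi)
    (xi_root : forall a, d.-unity_root (xi a))
    (pi : forall mu : composition n d, 'I_(multinom mu) -> 'S_n)
    (pi_enum : forall mu, coset_rep_enum (pi mu))
    (tau : forall mu : composition n d, {scalar young_heckeC R mu})
    (tauP : forall mu, is_tau uA_inv (tau mu))
    (Psi : forall mu : composition n d,
       EY uA vA (cst d%:R^-1) (fun a => cst (xi a)) mu ->
       'M[young_heckeC R mu]_(multinom mu))
    (PsiP : forall mu, is_Psi uA_inv (pi mu) (Psi mu))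
    (rho_tilde : {scalar yokonumaC R d n})
    (rho_tildeP : is_rho_tilde uA_inv rho_tilde) :
  rho_tilde =1 rho tau Psi.
Proof.
have xi_d a : xi a ^+ d = 1 by apply/unity_rootP.
have [f fE] := cst_rmorphism R.
apply: (rho_tilde_eq_rho (uA_invK R) _ _ _ pi_enum tauP PsiP) rho_tildeP.
- by rewrite -fE; apply: rmorph_invnat; rewrite Num.Theory.pnatr_eq0 -lt0n.
- by move=> a; rewrite -fE -rmorphXn xi_d rmorph1.
(* Distinctness of the roots turns equality of indices into equality of the roots themselves. *)
move=> a b; rewrite -!fE -(inj_eq xi_inj).
exact: rmorph_sum_unity_roots (xi_d a) (xi_d b).
Qed.
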